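(* Let $k$ be an algebraically closed field of characteristic zero, $S=k[x_0,\dots,x_n]$, and let $X=\bigcup_{i=1}^{\ell}X_i\subset\mathbb{P}^n$ be a chain of projective varieties $X_1,\dots,X_\ell$, i.e. for $i\neq j$ one has $X_i\cap X_j\neq\emptyset$ if and only if $|i-j|=1$. Let $I_{X_i}\subset S$ be the saturated homogeneous ideal of $X_i$, and let $X$ be defined by the saturated homogeneous ideal $I_X=\bigcap_{i=1}^{\ell} I_{X_i}$. Suppose that the homogeneous coordinates $x_0,\dots,x_n$ and a sequence of integers $n_0=0<n_1<\cdots<n_\ell=n$ satisfy $$X_i\subset\{x_0=\cdots=x_{n_{i-1}-1}=0,\ x_{n_i+1}=x_{n_i+2}=\cdots=x_n=0\},\qquad i=1,\dots,\ell.$$ Let $m$ be an integer which is at least the Gotzmann number of the Hilbert polynomial of $X$ and of each $X_i$. For $1\le i\le\ell-1$ let $T_i=\langle x_{n_{i-1}},\dots,x_{n_i-1}\rangle\,\langle x_{n_i+1},\dots,x_n\rangle$, and let $\tau\in\mathbb{R}^{n+1}$ be the point $\sum_{i=1}^{\ell-1}\mathcal{P}_m(T_i\cap k[x_{n_{i-1}},\dots,x_n])$ (each summand is a single point because $T_i$ is a monomial ideal). Let $\mathcal{V}_i$ denote the set of vertices of the $m$th state polytope $\mathcal{P}_m(I_{X_i}\cap k[x_{n_{i-1}},\dots,x_{n_i}])\subset\mathbb{R}^{n+1}$, $i=1,\dots,\ell$. Then the set of vertices of $\mathcal{P}_m(I_X)$ is precisely $$\Bigl\{\tau+\sum_{i=1}^{\ell}v_i\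 :\ v_i\in\mathcal{V}_i\Bigr\}.$$
   Context: State polytope. Let $0\le a\le b\le n$, $A=k[x_a,\dots,x_b]$, let $J\subset A$ be a homogeneous ideal, and let $A_m$, $J_m$ denote degree $m$ pieces, $Q=\dim_k J_m$. The line $\bigwedge^{Q}J_m\subset\bigwedge^{Q}A_m$ is the $m$th Hilbert point of $J$. The space $\bigwedge^{Q}A_m$ has a basis of wedge products $x^{\alpha(1)}\wedge\cdots\wedge x^{\alpha(Q)}$ of $Q$ distinct degree $m$ monomials, and such a wedge is a weight vector, of weight $\sum_{i=1}^{Q}\alpha(i)$, for the diagonal torus $R$ of $\mathrm{GL}(A_1)$ (acting by $t.x_j=t_jx_j$). The states of the Hilbert point are the weights $\chi$ for which a generator of $\bigwedge^{Q}J_m$ has nonzero $\chi$-component. The coefficient of $x^{\alpha(1)}\wedge\cdots\wedge x^{\alpha(Q)}$ in a generator is nonzero if and only if the degree $m$ monomials of $A$ other than $x^{\alpha(1)},\dots,x^{\alpha(Q)}$ form a $k$-basis of $A_m/J_m$. The $m$th state polytope $\mathcal{P}_m(J)$ is the convex hull of the set of states. Exponent vectors of monomials of $A$ are regarded as vectors in $\mathbb{R}^{n+1}$ (coordinates indexed $0,\dots,n$) whose coordinates with index outside $\{a,\dots,b\}$ are zero, so $\mathcal{P}_m(J)$ is regarded as a polytope in $\{\mathbf{a}\in\mathbb{R}^{n+1}: a_i=0\ \text{for } i<a \text{ and } i>b\}$. (If $J_m=0$, then $\mathcal{P}_m(J)=\{0\}$.) If $J$ is a monomial ideal, $\mathcal{P}_m(J)$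 is the single point $\sum_{x^\alpha\in J_m}\alpha$, the sum being over the degree $m$ monomials in $J$. *)

(* Defs.v *)
From mathcomp Require Import all_boot all_order all_algebra.
From mathcomp Require Import classical_sets reals.
From mathcomp Require Import mpoly.

Set Implicit Arguments.
Unset Strict Implicit.
Unset Printing Implicit Defensive.

Import GRing.Theory.
Local Open Scope ring_scope.
Local Open Scope classical_set_scope.

Section Ideals.
Variables (k : fieldType) (n : nat).
Local Notation S := {mpoly k[n.+1]}.

(* k[x_a, ..., x_b], as a subring of S *)
Definition subring_vars (a b : nat) : set S :=
  [set f | forall alpha, alpha \in msupp f ->
     forall j : 'I_n.+1, alpha j != 0%N -> (a <= j <= b)%N].

Definition ideal_gen (G : set S) : set S :=
  [set f | exists (r : nat) (g h : 'I_r -> S),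
     (forall i, G (g i)) /\ f = \sum_i h i * g i].

Definition ideal_mul (I J : set S) : set S :=
  ideal_gen [set f | exists g h, [/\ I g, J h & f = g * h]].

(* <x_a, ..., x_b> *)
Definition vars_ideal (a b : nat) : set S :=
  ideal_gen [set f | exists2 j : 'I_n.+1, (a <= j <= b)%N & f = 'X_j].

(* A subset of P^n is given by the set of all the representatives
   v <> 0 in k^(n+1) of its points. *)
Definition vanishing_locus (F : set S) : set 'rV[k]_n.+1 :=
  [set v : 'rV[k]_n.+1 | v != 0 /\ forall f, F f -> f.@[fun j => v 0 j] = 0].

(* Varieties are nonempty and reduced; they need not be irreducible. *)
Definition projective_variety (X : set 'rV[k]_n.+1) : Prop :=
  X !=set0 /\
  exists F : set S, (forall f, F f -> exists d, f \is d.-homog) /\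
    X = vanishing_locus F.

(* The homogeneous ideal generated by the forms vanishing on X: all the f
   whose homogeneous components vanish on X.  It is saturated. *)
Definition vanishing_ideal (X : set 'rV[k]_n.+1) : set S :=
  [set f | forall (d : nat) (v : 'rV[k]_n.+1), X v ->
     (pihomog mdeg d f).@[fun j => v 0 j] = 0].

(* V is the degree d piece J_d, as a subspace of S_d *)
Definition graded_piece (J : set S) (d : nat)
    (V : {vspace dhomog n.+1 k d}) : Prop :=
  forall f : dhomog n.+1 k d, f \in V <-> J (f : S).

Definition hilbert_polynomial (I : set S) (P : {poly rat}) : Prop :=
  exists d0 : nat, forall d, (d0 <= d)%N ->
    exists2 V : {vspace dhomog n.+1 k d}, graded_piece I V &
      P.[d%:R] = (\dim (fullv : {vspace dhomog n.+1 k d}))%:R - (\dim V)%:R.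

End Ideals.

(* the polynomial binom(t + c, a) in t *)
Definition binomial_poly (c : rat) (a : nat) : {poly rat} :=
  (a`!%:R)^-1 *: \prod_(j < a) ('X + (c - j%:R)%:P).

(* r is the number of terms of the Gotzmann representation
     P(t) = sum_(i = 1 .. r) binom(t + a_i - i + 1, a_i),
     a_1 >= ... >= a_r >= 0;
   indices are shifted to start at 0. *)
Definition gotzmann_number_poly (P : {poly rat}) (r : nat) : Prop :=
  exists2 a : 'I_r -> nat,
    (forall i j : 'I_r, (i <= j)%N -> (a j <= a i)%N) &
    P = \sum_(i < r) binomial_poly ((a i)%:R - i%:R) (a i).

(* the Gotzmann number of the Hilbert polynomial of S/I *)
Definition gotzmann_number (k : fieldType) (n : nat) (I : set {mpoly k[n.+1]})
    (r : nat) : Prop :=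
  exists2 P, hilbert_polynomial I P & gotzmann_number_poly P r.

Section StatePolytope.
Variables (R : realType) (k : fieldType) (n : nat).
Local Notation S := {mpoly k[n.+1]}.

Definition convex_hull (N : nat) (A : set 'rV[R]_N) : set 'rV[R]_N :=
  [set x | exists (r : nat) (w : 'I_r -> R) (p : 'I_r -> 'rV[R]_N),
     [/\ forall i, 0 <= w i, \sum_i w i = 1, forall i, A (p i)
       & x = \sum_i w i *: p i]].

Definition vertices (N : nat) (P : set 'rV[R]_N) : set 'rV[R]_N :=
  [set v | P v /\ forall (x y : 'rV[R]_N) (t : R), P x -> P y ->
     0 < t < 1 -> v = t *: x + (1 - t) *: y -> x = v /\ y = v].

(* The coefficient of x^(alpha 0) /\ ... /\ x^(alpha (Q-1)) in
   f_0 /\ ... /\ f_(Q-1), for the basis of wedges of distinct monomials. *)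
Definition wedge_coef (m Q : nat) (f : Q.-tuple (dhomog n.+1 k m))
    (alpha : 'I_Q -> 'X_{1..n.+1}) : k :=
  \det (\matrix_(i < Q, j < Q) (tnth f i : S)@_(alpha j)).

Definition exponent_vector (alpha : 'X_{1..n.+1}) : 'rV[R]_n.+1 :=
  \row_j (alpha j)%:R.

Definition weight (Q : nat) (alpha : 'I_Q -> 'X_{1..n.+1}) : 'rV[R]_n.+1 :=
  \sum_(i < Q) exponent_vector (alpha i).

(* States of the m-th Hilbert point of J, for J an ideal of
   A = k[x_a, ..., x_b], J being seen as a subset of S.  As wedges of distinct
   monomials are linearly independent, the chi-component of f_0 /\ ... /\
   f_(Q-1) is nonzero iff some wedge of weight chi has a nonzero coefficient. *)
Definition states (a b : nat) (J : set S) (m : nat) : set 'rV[R]_n.+1 :=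
  [set chi | exists (V : {vspace dhomog n.+1 k m})
       (f : (\dim V).-tuple (dhomog n.+1 k m))
       (alpha : 'I_(\dim V) -> 'X_{1..n.+1}),
     [/\ graded_piece J V, basis_of V f,
         injective alpha /\ (forall i, mdeg (alpha i) = m /\
           subring_vars a b ('X_[alpha i] : S)),
         wedge_coef f alpha != 0
       & chi = weight alpha]].

Definition state_polytope (a b : nat) (J : set S) (m : nat) :
    set 'rV[R]_n.+1 :=
  convex_hull (states a b J m).

End StatePolytope.

(* Main.v *)
Require Import Defs.
From mathcomp Require Import all_boot all_order all_algebra.
From mathcomp Require Import boolp classical_sets reals.
From mathcomp Require Import mpoly.

Set Implicit Arguments.
Unset Strict Implicit.
Unset Printing Implicit Defensive.

Import Order.TTheory GRing.Theory Num.Theory.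
Local Open Scope ring_scope.

(** Why the theorem holds.  Split the monomials of degree m into the crossing
    ones, whose support lies in no block [N i, N i.+1] of coordinates, and
    those supported in some block.  A crossing monomial vanishes on every
    X i, so it belongs to I_X; the crossing monomials whose least variable has
    index in [N i, N i.+1 - 1] are exactly the monomials of degree m of T i
    in the variables of index at least N i, so they contribute tau i.  A form
    f lies in I_X iff, for each i, the part of f supported in block i
    vanishes on X i.

    The only monomials lying in two blocks are the powers of x_(N i).  The
    components X (i - 1) and X i meet, and their intersection lies in the
    coordinate point of index N i, so a form vanishing on one of them has
    coefficient zero on such a power.  Hence the degree m piece of I_X is the
    direct sum of the span of the crossing monomials and of the degree m
    pieces of the ideals of the X i in their blocks, and these summands have
    pairwise disjoint sets of monomials ([graded_piece_chain]).

    The states of an ideal are read off the sets of monomials on which the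
    coefficient functionals form a basis of the dual of its degree m piece
    ([statesP]): the matroid of the piece.  For a direct sum with disjoint
    monomial supports the bases of the matroid are the unions of bases of the
    summands ([coef_basis_sum]), so the states of I_X are the sums of
    sum_i tau i and of one state for each X i ([states_chain]).

    In general the vertices of a Minkowski sum are only some of the sums of
    vertices.  Here all of them occur, because a sum of points of the state
    polytopes of the X i determines its summands ([block_sum_inj]): the sum of
    the coordinates is constant on each of these polytopes, and consecutive
    blocks share just one coordinate. *)

(** * Coefficient functionals on a space of forms *)

Section CoefficientBases.
Variables (k : fieldType) (n m : nat).
Local Notation S := {mpoly k[n.+1]}.
Local Notation W := (dhomog n.+1 k m).
Local Notation M := 'X_{1..n.+1 < m.+1}.

Lemma mcoeff_dhomog_neq0 (f : W) (a : 'X_{1..n.+1}) :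
  (f : S)@_a != 0 -> mdeg a = m.
Proof.
move=> fa; apply/eqP; apply: contraNT fa => am; apply/eqP.
by apply: dhomog_nemf_coeff am; exact: dhomog_is_dhomog.
Qed.

Lemma dhomog_eqP (f g : W) : (forall b : M, (f : S)@_b = (g : S)@_b) -> f = g.
Proof.
move=> fg; apply/val_inj/mpolyP => a /=.
have [am|am] := eqVneq (mdeg a) m; last first.
  by rewrite !(@dhomog_nemf_coeff _ _ mdeg m) //; exact: dhomog_is_dhomog.
have ha : (mdeg a < m.+1)%N by rewrite am.
exact: (fg (BMultinom ha)).
Qed.

Definition separates (V : {vspace W}) (B : {set M}) :=
  forall g, g \in V -> (forall b : M, b \in B -> (g : S)@_b = 0) -> g = 0.

(** The bases of the matroid which the coefficient functionals define on the
    dual of V. *)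
Definition coef_basis (V : {vspace W}) (B : {set M}) :=
  separates V B /\ #|B| = \dim V.

Definition supported (E : {set M}) (V : {vspace W}) :=
  forall g, g \in V -> forall b : M, b \notin E -> (g : S)@_b = 0.

Definition coef_mx (Q p : nat) (f : Q.-tuple W) (alpha : 'I_p -> 'X_{1..n.+1}) :
    'M[k]_(Q, p) :=
  \matrix_(i < Q, j < p) (tnth f i : S)@_(alpha j).

(** The rows of the coefficient matrix of a basis of V are independent iff no
    nonzero element of V has all the chosen coefficients zero; this condition
    no longer mentions the basis, which makes the nonvanishing of a Pluecker
    coordinate independent of it. *)
Lemma row_free_coef_mx (V : {vspace W}) (f : (\dim V).-tuple W) p
    (alpha : 'I_p -> 'X_{1..n.+1}) : basis_of V f ->
  row_free (coef_mx f alpha) <->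
  (forall g, g \in V -> (forall j, (g : S)@_(alpha j) = 0) -> g = 0).
Proof.
move=> fV.
have coefE (v : 'rV_(\dim V)) j :
    (v *m coef_mx f alpha) 0 j = ((\sum_i v 0 i *: f`_i : W) : S)@_(alpha j).
  rewrite !mxE (raddf_sum (@mpoly_of_dhomog n.+1 k m)) raddf_sum /=.
  by apply: eq_bigr => i _; rewrite mxE (tnth_nth 0) mcoeffZ.
split=> [fr g gV g0|sep].
  rewrite (coord_basis fV gV).
  have /eqP : \row_i coord f i g *m coef_mx f alpha = 0.
    apply/rowP => j; rewrite coefE !mxE -[RHS](g0 j) {2}(coord_basis fV gV).
    congr ((_ : W) : S)@_(_).
    by apply: eq_bigr => i _; rewrite mxE.
  rewrite mulmx_free_eq0 // => /eqP /rowP c0.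
  by apply: big1 => i _; have := c0 i; rewrite !mxE => ->; rewrite scale0r.
apply: inj_row_free => v v0; apply/rowP => i; rewrite mxE.
have /freeP fr := basis_free fV.
apply: (fr (fun i => v 0 i)).
apply: sep => [|j]; last by rewrite -coefE v0 mxE.
apply: memv_suml => j _; rewrite memvZ // (basis_mem fV) // mem_nth //.
by rewrite size_tuple.
Qed.

Lemma separates_enum V (B : {set M}) : separates V B <->
  (forall g, g \in V ->
     (forall j : 'I_#|B|, (g : S)@_(enum_val j : M) = 0) -> g = 0).
Proof.
split=> sep g gV g0; apply: sep => //; last first.
  by move=> j; apply/g0/enum_valP.
by move=> b bB; have := g0 (enum_rank_in bB b); rewrite enum_rankK_in.
Qed.

Lemma separates_dim V B : separates V B -> (\dim V <= #|B|)%N.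
Proof.
move=> /separates_enum /(row_free_coef_mx _ (vbasisP V)) /eqP <-.
exact: rank_leq_col.
Qed.

(** A full rank submatrix of the matrix of all the coefficients of a basis of
    V selects the monomials. *)
Lemma coef_basis_exists V : exists B, coef_basis V B.
Proof.
have : row_free
    (coef_mx (vbasis V) (fun j : 'I_#|[set: M]| => (enum_val j : M))).
  apply/(row_free_coef_mx _ (vbasisP V)); apply/separates_enum => g _ g0.
  by apply: dhomog_eqP => b; rewrite g0 ?inE // mcoeff0.
set A := coef_mx _ _ => Afree.
have fA : row_full A^T by rewrite /row_full mxrank_tr.
pose h : _ -> M := fun j => enum_val (fullrankfun fA j).
have hinj : injective h by move=> i j /enum_val_inj /fullrankfun_inj.
exists [set h j | j in 'I_(\dim V)]; split; last first.
  by rewrite card_imset // card_ord.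
move=> g gV g0.
have : row_free (coef_mx (vbasis V) (fun j => (h j : 'X_{1..n.+1}))).
  rewrite row_free_unit -unitmx_tr.
  have := fullrowsub_unit fA; congr (_ \in unitmx).
  by apply/matrixP => i j; rewrite !mxE.
move/(row_free_coef_mx _ (vbasisP V)); apply=> // j.
by apply: g0; apply: imset_f.
Qed.

(** Intersecting a basis with the support E keeps it separating, and a
    separating set has at least \dim V elements, so nothing was removed. *)
Lemma coef_basis_sub V E B : supported E V -> coef_basis V B -> B \subset E.
Proof.
move=> VE [sep cB].
have : separates V (B :&: E).
  move=> g gV g0; apply: sep => // b bB.
  have [bE|bE] := boolP (b \in E); last exact: VE.
  by apply: g0; rewrite inE bB.
move=> /separates_dim; rewrite -cB => leB.
by apply/finset.setIidPl/eqP; rewrite eqEcard finset.subsetIl.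
Qed.

Section DirectSum.
Variables (K : finType) (E : K -> {set M}) (U : K -> {vspace W}).
Hypothesis EK : forall i j, i != j -> [disjoint E i & E j].
Hypothesis UE : forall i, supported (E i) (U i).

Let mcoeff_sumU (g : K -> W) i b : (forall i, g i \in U i) -> b \in E i ->
  ((\sum_j g j : W) : S)@_b = (g i : S)@_b.
Proof.
move=> gU bE; rewrite (raddf_sum (@mpoly_of_dhomog n.+1 k m)) raddf_sum /=.
rewrite (bigD1 i) //= big1 ?addr0 // => j ji.
by apply: (UE (gU j)); rewrite (disjointFr (EK _) bE) // eq_sym.
Qed.

Lemma dim_sum_supported : \dim (\sum_i U i)%VS = (\sum_i \dim (U i))%N.
Proof.
apply/eqP; rewrite -[_ == _]/(directv (\sum_i U i)%VS).
apply/directv_sum_independent => g gU g0 i _.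
apply: dhomog_eqP => b; rewrite mcoeff0.
have [bE|bE] := boolP (b \in E i); last exact: (UE (gU i isT)).
by rewrite -(mcoeff_sumU (fun i => gU i isT) bE) g0 mcoeff0.
Qed.

(** For a basis B of the sum, each B :&: E i separates U i, so it has at least
    \dim (U i) elements; as these numbers add up to #|B|, all the inequalities
    are equalities and B is the union of these intersections. *)
Lemma coef_basis_sum (B : {set M}) :
  coef_basis (\sum_i U i)%VS B <->
  exists2 C : K -> {set M}, (forall i, coef_basis (U i) (C i)) &
    B = \bigcup_i C i.
Proof.
split=> [[sep cB]|[C CU ->{B}]].
  pose C i := B :&: E i.
  have CK i j : i != j -> [disjoint C i & C j].
    by move=> /EK; apply: disjointW; exact: finset.subsetIr.
  have sepC i : separates (U i) (C i).
    move=> g gU g0; apply: sep => [|b bB].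
      by rewrite memvE (sumv_sup i) // -memvE.
    have [bE|bE] := boolP (b \in E i); last exact: (UE gU).
    by apply: g0; rewrite inE bB.
  have sCB : \bigcup_i C i \subset B.
    by apply/finset.bigcupsP => i _; exact: finset.subsetIl.
  have cC : #|\bigcup_i C i| = (\sum_i #|C i|)%N.
    rewrite -sum1_card partition_disjoint_bigcup //.
    by apply: eq_bigr => i _; rewrite sum1_card.
  have le1 := subset_leq_card sCB.
  have [le2 eq2] : (\sum_i \dim (U i) <= \sum_i #|C i|
      ?= iff [forall i, \dim (U i) == #|C i|])%N.
    apply: leqif_sum => i _; split=> //; exact: separates_dim.
  rewrite cC cB dim_sum_supported in le1.
  have eqC : (\sum_i \dim (U i) = \sum_i #|C i|)%N.
    by apply/eqP; rewrite eqn_leq le2.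
  exists C.
    move: eq2; rewrite eqC eqxx => /esym /forallP dimC i.
    by split=> //; rewrite (eqP (dimC i)).
  by apply/esym/eqP; rewrite eqEcard sCB cC cB dim_sum_supported eqC /=.
have CE i : C i \subset E i by apply: coef_basis_sub (CU i).
split; last first.
  rewrite -sum1_card partition_disjoint_bigcup => [|i j ij]; last first.
    exact: (disjointW (CE i) (CE j) (EK ij)).
  rewrite dim_sum_supported; apply: eq_bigr => i _.
  by rewrite sum1_card (CU i).2.
move=> _ /memv_sumP[g gU ->] g0; apply: big1 => i _.
apply: (CU i).1 => [|b bC]; first exact: gU.
rewrite -(mcoeff_sumU (fun i => gU i isT) (fintype.subsetP (CE i) b bC)).
by apply: g0; apply/finset.bigcupP; exists i.
Qed.

End DirectSum.

(** If b in E were missing from a basis, the monomial b would be a nonzero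
    element of V with no coefficient on that basis. *)
Lemma coef_basis_monomial V E : supported E V ->
  (forall b : M, b \in E -> mdeg b = m) ->
  (forall f : W, (forall b : M, b \notin E -> (f : S)@_b = 0) -> f \in V) ->
  forall B, coef_basis V B <-> B = E.
Proof.
move=> VE Em EV B.
suff Beq C : coef_basis V C -> C = E.
  split=> [|->]; first exact: Beq.
  by have [C CV] := coef_basis_exists V; rewrite -(Beq C CV).
move=> CV; apply/eqP; rewrite finset.eqEsubset (coef_basis_sub VE CV) /=.
apply/fintype.subsetP => b bE; apply/negPn/negP => bC.
have bh : ('X_[b] : S) \is m.-homog by rewrite dhomogX; apply/eqP/Em.
have bV : DHomog bh \in V.
  apply: EV => c cE /=; rewrite mcoeffX.
  by case: ((b : 'X_{1..n.+1}) =P c) => // /val_inj bc; rewrite -bc bE in cE.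
have : DHomog bh = 0.
  apply: CV.1 => // c cC; rewrite mcoeffX.
  by case: eqP => // /val_inj bc; move: bC; rewrite bc cC.
move=> /(congr1 (fun f : W => (f : S)@_b)); rewrite /= mcoeffX eqxx mcoeff0.
by move/eqP; rewrite oner_eq0.
Qed.

End CoefficientBases.

(** * States *)

Section States.
Variables (R : realType) (k : fieldType) (n m : nat).
Local Notation S := {mpoly k[n.+1]}.
Local Notation W := (dhomog n.+1 k m).
Local Notation M := 'X_{1..n.+1 < m.+1}.

Definition in_vars (a b : nat) (c : 'X_{1..n.+1}) : bool :=
  [forall j : 'I_n.+1, (c j != 0%N) ==> (a <= j <= b)%N].

Lemma in_varsP a b (c : 'X_{1..n.+1}) :
  reflect (forall j, c j != 0%N -> (a <= j <= b)%N) (in_vars a b c).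
Proof. by apply: (iffP forallP) => h j; apply/implyP; exact: h. Qed.

Lemma subring_varsP a b (f : S) :
  subring_vars a b f <-> (forall c, (f : S)@_c != 0 -> in_vars a b c).
Proof.
split=> [fab c fc|fab c].
  by apply/forallP => j; apply/implyP; apply: fab; rewrite mcoeff_msupp.
rewrite mcoeff_msupp => /fab /forallP fc j cj.
exact: (implyP (fc j)).
Qed.

Lemma subring_varsX a b (c : 'X_{1..n.+1}) :
  subring_vars a b ('X_[c] : S) <-> in_vars a b c.
Proof.
split=> [/subring_varsP|cab]; first by apply; rewrite mcoeffX eqxx oner_eq0.
apply/subring_varsP => d; rewrite mcoeffX.
by case: (c =P d) => [<-|]; rewrite ?eqxx.
Qed.

Lemma bmultinom_exists (a : 'X_{1..n.+1}) :
  mdeg a = m -> exists b : M, a = b :> 'X_{1..n.+1}.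
Proof.
move=> am; have ha : (mdeg a < m.+1)%N by rewrite am.
by exists (BMultinom ha).
Qed.

(** The piece V of J determines the states: a Pluecker coordinate of V is
    nonzero exactly when its monomials form a basis for V. *)
Lemma statesP a b (J : set S) V (E : {set M}) (chi : 'rV[R]_n.+1) :
  graded_piece J V -> supported E V ->
  (forall c : M, c \in E -> mdeg c = m /\ in_vars a b c) ->
  states a b J m chi <->
  exists2 B, coef_basis V B & chi = \sum_(c in B) exponent_vector R c.
Proof.
move=> JV VE Eab; split=> [|[B BV ->]].
  move=> [V' [f [alpha [JV' fV [alpha_inj alphaP] det_neq0 ->]]]].
  have eV : V' = V.
    by apply/vspaceP => g; apply/idP/idP => [/JV'/JV|/JV/JV'].
  move: V' eV JV' f fV alpha alpha_inj alphaP det_neq0 => _ -> _ f fV.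
  move=> alpha alpha_inj alphaP det_neq0.
  have /fin_all_exists[h hE] i := bmultinom_exists (alphaP i).1.
  have hinj : injective h.
    by move=> i j hij; apply: alpha_inj; rewrite !hE hij.
  exists [set h i | i in 'I_(\dim V)]; last first.
    rewrite big_imset /=; last by move=> i j _ _ /hinj.
    by apply: eq_bigr => i _; rewrite hE.
  split; last by rewrite card_imset // card_ord.
  have : row_free (coef_mx f alpha) by rewrite row_free_unit unitmxE unitfE.
  move/(row_free_coef_mx _ fV) => sep g gV g0; apply: sep => // j.
  by rewrite hE g0 // imset_f.
have BE := coef_basis_sub VE BV; have [sep cB] := BV.
pose alpha i : 'X_{1..n.+1} := (enum_val (cast_ord (esym cB) i) : M).
have alphaB i : enum_val (cast_ord (esym cB) i) \in B by exact: enum_valP.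
exists V, (vbasis V), alpha; split=> //.
- exact: vbasisP.
- split=> [i j /val_inj/enum_val_inj/cast_ord_inj //|i].
  have [-> cab] := Eab _ (fintype.subsetP BE _ (alphaB i)).
  by split=> //; apply/subring_varsX.
- rewrite /wedge_coef -/(coef_mx _ _) -unitfE -unitmxE -row_free_unit.
  apply/(row_free_coef_mx _ (vbasisP V)) => g gV g0; apply: sep => // c cB'.
  have := g0 (cast_ord cB (enum_rank_in cB' c)).
  by rewrite /alpha cast_ordK enum_rankK_in.
rewrite /weight big_enum_val /=.
rewrite (reindex (cast_ord (esym cB))) //=.
by exists (cast_ord cB) => i _; rewrite ?cast_ordK ?cast_ordKV.
Qed.

(** Both facts are affine conditions on x, hence hold on the whole state
    polytope.  That the sum of the coordinates is the same for all states is
    what makes block polytopes sharing a coordinate independent. *)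
Lemma weight_block a b (J : set S) (x : 'rV[R]_n.+1) : states a b J m x ->
  (forall t : 'I_n.+1, ~~ (a <= t <= b)%N -> x 0 t = 0) /\
  (forall V : {vspace W}, graded_piece J V -> \sum_t x 0 t = (m * \dim V)%:R).
Proof.
move=> [V [f [alpha [JV _ [_ alphaP] _ ->]]]]; split=> [t tab|V' JV'].
  rewrite /weight summxE big1 // => i _; rewrite mxE.
  have [_ /subring_varsX/in_varsP ab] := alphaP i.
  by have [->//|/ab] := eqVneq (alpha i t) 0%N; rewrite (negPf tab).
have -> : V' = V by apply/vspaceP => g; apply/idP/idP => [/JV'/JV|/JV/JV'].
under eq_bigr do rewrite /weight summxE.
rewrite exchange_big /= (eq_bigr (fun=> m%:R)) => [|i _].
  by rewrite sumr_const card_ord natrM mulr_natr.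
under eq_bigr do rewrite mxE.
by rewrite -natr_sum -mdegE (alphaP i).1.
Qed.

End States.

(** Among the subspaces contained in P, one of maximal dimension contains every
    vector of P. *)
Lemma subspace_exists (k : fieldType) (vT : vectType k) (P : vT -> Prop) :
  P 0 -> (forall a f g, P f -> P g -> P (a *: f + g)) ->
  exists V : {vspace vT}, forall f, f \in V <-> P f.
Proof.
move=> P0 Plin.
pose Q d :=
  `[< exists2 U : {vspace vT}, \dim U = d & forall f, f \in U -> P f >].
have exQ : exists d, Q d.
  exists 0%N; apply/asboolP; exists 0%VS; first exact: dimv0.
  by move=> f; rewrite memv0 => /eqP->.
have leQ d : Q d -> (d <= \dim {: vT})%N.
  by move=> /asboolP[U <- _]; rewrite dimvS // subvf.
case: (ex_maxnP exQ leQ) => d /asboolP[U dU UP] dmax.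
exists U => f; split=> [|Pf]; first exact: UP.
apply/negPn/negP => fU.
have : Q (\dim (<[f]> + U)%VS).
  apply/asboolP; exists (<[f]> + U)%VS => // h.
  move=> /memv_addP[_ /vlineP[a ->] [g gU ->]].
  exact: Plin (UP _ gU).
move/dmax; rewrite -dU leqNgt => /negP; apply.
have UfU : (U <= <[f]> + U)%VS by exact: addvSr.
rewrite (ltn_leqif (dimv_leqif_sup UfU)) subv_add subvv andbT.
by rewrite -memvE.
Qed.

Section Projection.
Variables (k : fieldType) (n m : nat).
Local Notation S := {mpoly k[n.+1]}.
Local Notation W := (dhomog n.+1 k m).
Local Notation M := 'X_{1..n.+1 < m.+1}.

Definition coef_proj (E : {set M}) (f : W) : W :=
  \sum_(b in E) (f : S)@_b *: indhomog m ('X_[b] : S).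

Lemma mcoeff_proj E f (b : M) :
  (coef_proj E f : S)@_b = if b \in E then (f : S)@_b else 0.
Proof.
have mX (c : M) : mdeg c = m -> (indhomog m 'X_[c] : S) = 'X_[c].
  move=> cm; apply: (@insubdK _ _ (dhomog n.+1 k m)).
  by apply/dhomogP => d /mem_msuppXP <-.
rewrite /coef_proj (raddf_sum (@mpoly_of_dhomog n.+1 k m)) raddf_sum /=.
transitivity (\sum_(c in E) (f : S)@_c * (c == b)%:R).
  apply: eq_bigr => c _; rewrite mcoeffZ.
  have [->|/mcoeff_dhomog_neq0 cm] := eqVneq (f : S)@_c 0.
    by rewrite !mul0r.
  by rewrite mX // mcoeffX.
case: ifP => bE; last first.
  apply: big1 => c cE; case: eqP => [cb|]; last by rewrite mulr0.
  by move: bE; rewrite -cb cE.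
rewrite (bigD1 b) //= eqxx mulr1 big1 ?addr0 // => c /andP[_ /negPf->].
by rewrite mulr0.
Qed.

Lemma meval_dhomog_eq (v : 'I_n.+1 -> k) (f g : W) :
  (forall b : M, (f : S)@_b != (g : S)@_b -> ('X_[b] : S).@[v] = 0) ->
  (f : S).@[v] = (g : S).@[v].
Proof.
move=> fg; apply/eqP; rewrite -subr_eq0 -mevalB mevalE; apply/eqP.
apply: big1_seq => a /andP[_]; rewrite mcoeff_msupp mcoeffB => ha.
have [b ab] : exists b : M, a = b :> 'X_{1..n.+1}.
  apply/bmultinom_exists/(@mcoeff_dhomog_neq0 k n m (f - g)).
  by rewrite mcoeffB.
by rewrite ab -mevalX fg ?mulr0 // -ab -subr_eq0.
Qed.

Lemma mevalX_eq0 (v : 'I_n.+1 -> k) (b : 'X_{1..n.+1}) j :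
  b j != 0%N -> v j = 0 -> ('X_[b] : S).@[v] = 0.
Proof.
by move=> bj vj; rewrite mevalX (bigD1 j) //= vj expr0n (negPf bj) mul0r.
Qed.

End Projection.

(** * Vertices of Minkowski sums *)

Section Convexity.
Variables (R : realType) (N : nat).
Implicit Types (A : set 'rV[R]_N).

Lemma sub_convex_hull A x : A x -> convex_hull A x.
Proof.
move=> Ax; exists 1%N, (fun=> 1), (fun=> x); split=> //.
  by rewrite big_ord1.
by rewrite big_ord1 scale1r.
Qed.

Lemma convex_hull1 (a : 'rV[R]_N) A :
  (forall x, A x <-> x = a) -> convex_hull A = [set a]%classic.
Proof.
move=> Aa; apply/seteqP; split=> x /=.
  move=> [r [w [p [w0 w1 pA ->]]]].
  rewrite (eq_bigr (fun i => w i *: a)) => [|i _].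
    by rewrite -scaler_suml w1 scale1r.
  by rewrite (proj1 (Aa _) (pA i)).
by move=> ->; apply/sub_convex_hull/Aa.
Qed.

Lemma convex_hull_mulmx A q (u : 'M[R]_(N, q)) c :
  (forall x, A x -> x *m u = c) -> forall x, convex_hull A x -> x *m u = c.
Proof.
move=> Ac _ [r [w [p [_ w1 pA ->]]]].
rewrite mulmx_suml (eq_bigr (fun i => w i *: c)) => [|i _].
  by rewrite -scaler_suml w1 scale1r.
by rewrite -scalemxAl Ac.
Qed.

Lemma convex_hull_segment A x y t : convex_hull A x -> convex_hull A y ->
  0 < t < 1 -> convex_hull A (t *: x + (1 - t) *: y).
Proof.
move=> [r [w [p [w0 w1 pA ->]]]] [s [z [q [z0 z1 qA ->]]]] /andP[t0 t1].
exists (r + s)%N, (fun i => match split i with inl i => t * w i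
                            | inr j => (1 - t) * z j end),
  (fun i => match split i with inl i => p i | inr j => q j end); split.
- move=> i; case: (split i) => j; rewrite mulr_ge0 // ?subr_ge0 ltW //.
- rewrite big_split_ord /=.
  rewrite (eq_bigr (fun i => t * w i)) => [|i _]; last first.
    by rewrite (unsplitK (inl _ i)).
  rewrite [X in _ + X](eq_bigr (fun i => (1 - t) * z i)) => [|i _]; last first.
    by rewrite (unsplitK (inr _ i)).
  by rewrite -!mulr_sumr w1 z1 !mulr1 addrC subrK.
- by move=> i; case: (split i).
rewrite big_split_ord /= !scaler_sumr; congr (_ + _); apply: eq_bigr => i _.
  by rewrite (unsplitK (inl _ i)) scalerA.
by rewrite (unsplitK (inr _ i)) scalerA.
Qed.

(** In a convex combination equal to v, take a point p i of positive weight.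
    If its weight is 1 then v = p i.  Otherwise v lies inside the segment
    joining p i to the normalized combination of the other points, and v = p i
    because v is extreme. *)
Lemma vertices_hull_sub A v : vertices (convex_hull A) v -> A v.
Proof.
move=> [[r [w [p [w0 w1 pA vE]]]] vext].
have [i wi] : exists i, 0 < w i.
  apply: contrapT => nw.
  have : \sum_i w i = 0.
    apply: big1 => i _; apply/le_anti; rewrite w0 andbT leNgt.
    by apply/negP => wi; apply: nw; exists i.
  by move/eqP; rewrite w1 oner_eq0.
have w1i : w i + \sum_(j | j != i) w j = 1 by rewrite -w1 [RHS](bigD1 i).
have [wi1|wi1] := ltP (w i) 1; last first.
  have wj0 j : j != i -> w j = 0.
    apply: (psumr_eq0P (P := fun j => j != i)) => [j' _|]; first exact: w0.
    apply/le_anti; rewrite sumr_ge0 // andbT.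
    by rewrite -(lerD2l (w i)) w1i addr0.
  have wiE : w i = 1.
    by rewrite -[LHS]addr0 -[in RHS]w1i [X in _ = _ + X]big1.
  suff -> : v = p i by [].
  rewrite vE (bigD1 i) //= wiE scale1r big1 ?addr0 // => j /wj0->.
  by rewrite scale0r.
(* The weights of the combination of the other points. *)
pose z j := if j == i then 0 else w j / (1 - w i).
have hz : convex_hull A (\sum_j z j *: p j).
  exists r, z, p; split=> //.
    move=> j; rewrite /z; case: eqP => // _.
    by rewrite divr_ge0 // subr_ge0 ltW.
  rewrite (bigD1 i) //= /z eqxx add0r (eq_bigr (fun j => w j / (1 - w i))).
    rewrite -mulr_suml; have -> : \sum_(j | j != i) w j = 1 - w i.
      by rewrite -w1i addrC addKr.
    by rewrite divff // subr_eq0 gt_eqF.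
  by move=> j /negPf->.
have hp : convex_hull A (p i) by exact: sub_convex_hull.
have [] := vext (p i) (\sum_j z j *: p j) (w i) hp hz.
- by rewrite wi.
- rewrite vE (bigD1 i) //= [in RHS](bigD1 i) //= {1}/z eqxx scale0r add0r.
  congr (_ + _); rewrite scaler_sumr; apply: eq_bigr => j /negPf ji.
  by rewrite /z ji scalerA mulrC divfK // subr_eq0 gt_eqF.
by move=> <- _.
Qed.

Section MinkowskiSum.
Variables (I : finType) (B : I -> set 'rV[R]_N) (A : set 'rV[R]_N).
Variable tau : 'rV[R]_N.
Hypothesis AE : forall x, A x <->
  exists2 b : I -> 'rV[R]_N, (forall i, B i (b i)) & x = tau + \sum_i b i.

Lemma convex_hull_sum x : convex_hull A x ->
  exists2 b : I -> 'rV[R]_N, (forall i, convex_hull (B i) (b i)) &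
    x = tau + \sum_i b i.
Proof.
move=> [r [w [p [w0 w1 pA ->]]]].
have /fin_all_exists[c cP] : forall j : 'I_r, exists b : I -> 'rV[R]_N,
    (forall i, B i (b i)) /\ p j = tau + \sum_i b i.
  by move=> j; have /AE[b bB pE] := pA j; exists b.
exists (fun i => \sum_j w j *: c j i).
  by move=> i; exists r, w, (fun j => c j i); split=> // j; exact: (cP j).1.
rewrite exchange_big /= -[tau in RHS]scale1r -w1 scaler_suml -big_split /=.
by apply: eq_bigr => j _; rewrite (cP j).2 scalerDr -scaler_sumr.
Qed.

(** Only one summand leaves B i here, which is enough below because vertices of
    the hull of A belong to A. *)
Lemma convex_hull_exchange (b : I -> 'rV[R]_N) i x : (forall i, B i (b i)) ->
  convex_hull (B i) x -> convex_hull A (tau + \sum_j b j - b i + x).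
Proof.
move=> bB [r [w [p [w0 w1 pB ->]]]].
exists r, w, (fun j => tau + \sum_j b j - b i + p j); split=> // [j|].
  apply/AE; exists (fun i' => if i' == i then p j else b i').
    by move=> i'; case: eqP => [->|].
  rewrite (bigD1 i) //= [in RHS](bigD1 i) //= eqxx.
  rewrite [in RHS](eq_bigr b) => [|i' /negPf-> //].
  by rewrite [b i + _]addrC addrA addrK [p j + _]addrC addrA.
under [RHS]eq_bigr do rewrite scalerDr.
by rewrite big_split /= -scaler_suml w1 scale1r.
Qed.

Hypothesis sum_inj : forall x y : I -> 'rV[R]_N,
  (forall i, convex_hull (B i) (x i)) -> (forall i, convex_hull (B i) (y i)) ->
  \sum_i x i = \sum_i y i -> forall i, x i = y i.

(** If v is a vertex, so is each summand: a segment of convex_hull (B i) through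
    b i, translated by the other summands, is a segment through v.  Conversely,
    a segment through the sum of the b i is, by [sum_inj], a sum of segments
    through the b i. *)
Lemma vertices_minkowski_sum v : vertices (convex_hull A) v <->
  exists2 b : I -> 'rV[R]_N, (forall i, vertices (convex_hull (B i)) (b i)) &
    v = tau + \sum_i b i.
Proof.
split=> [vA|[b bV vE]].
  have /AE[b bB vE] := vertices_hull_sub vA.
  exists b => // i; split=> [|x y t xB yB t01 bE]; first exact: sub_convex_hull.
  have [] := vA.2 _ _ t
    (convex_hull_exchange bB xB) (convex_hull_exchange bB yB) t01.
    rewrite -vE -[LHS](subrK (b i)) {2}bE; move: (v - b i) => c.
    rewrite !scalerDr addrACA -scalerDl addrC [t + _]addrC subrK scale1r.
    by rewrite addrC.
  rewrite -vE => Ex Ey.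
  by split; apply: (addrI (v - b i)); rewrite ?Ex ?Ey subrK.
have bB i : B i (b i) by exact: vertices_hull_sub (bV i).
split; first by apply/sub_convex_hull/AE; exists b.
move=> x y t /convex_hull_sum[x' xB ->] /convex_hull_sum[y' yB ->] t01 E.
have bE : forall i, b i = t *: x' i + (1 - t) *: y' i.
  apply: sum_inj => [i|i|]; first exact: (bV i).1.
    exact: convex_hull_segment.
  apply: (addrI tau); rewrite -vE E !scalerDr addrACA -scalerDl.
  by rewrite [t + _]addrC subrK scale1r big_split /= -!scaler_sumr.
suff bxy i : x' i = b i /\ y' i = b i.
  rewrite vE; split; congr (_ + _); apply: eq_bigr => j _.
    by have [] := bxy j.
  by have [] := bxy j.
exact: (bV i).2 (xB i) (yB i) t01 (bE i).
Qed.

End MinkowskiSum.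
End Convexity.

(** * Ideals generated by products of variables *)

Section MonomialIdeals.
Variables (k : fieldType) (n : nat).
Local Notation S := {mpoly k[n.+1]}.

Lemma ideal_gen_msupp (P : 'X_{1..n.+1} -> Prop) (G : set S) (f : S) :
  (forall a b, P a -> P (b + a)%MM) ->
  (forall g, G g -> forall a, a \in msupp g -> P a) ->
  ideal_gen G f -> forall a, a \in msupp f -> P a.
Proof.
move=> Pup GP [r [g [h [gG ->]]]] a; rewrite mcoeff_msupp raddf_sum /= => fa.
have [i hgi] : exists i, (h i * g i)@_a != 0.
  apply: contrapT => nhg; move/eqP: fa; apply; apply: big1 => i _.
  by apply/eqP/negPn/negP => hgi; apply: nhg; exists i.
move: hgi; rewrite -mcoeff_msupp => /msuppM_le/allpairsP[[b c] /= [_ cg ->]].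
exact/Pup/(GP _ (gG i)).
Qed.

Definition meets_vars (a b : nat) (c : 'X_{1..n.+1}) :=
  exists2 j : 'I_n.+1, (a <= j <= b)%N & c j != 0%N.

Lemma meets_varsD a b c d : meets_vars a b c -> meets_vars a b (d + c)%MM.
Proof.
by move=> [j jab cj]; exists j; rewrite // mnmDE addn_eq0 negb_and cj orbT.
Qed.

Lemma vars_ideal_msupp a b (f : S) : vars_ideal a b f ->
  forall c, c \in msupp f -> meets_vars a b c.
Proof.
apply: ideal_gen_msupp => [c d|_ [j jab ->] c]; first exact: meets_varsD.
by rewrite msuppX mem_seq1 => /eqP->; exists j; rewrite // mnm1E eqxx.
Qed.

(** As the two ranges of variables are disjoint, a monomial meeting both is
    divisible by the product of one variable from each. *)
Lemma mul_vars_idealP a b c d (f : S) : (b < c)%N ->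
  ideal_mul (vars_ideal a b) (vars_ideal c d) f <->
  (forall e, (f : S)@_e != 0 -> meets_vars a b e /\ meets_vars c d e).
Proof.
move=> bc; split=> [If e|fP].
  rewrite -mcoeff_msupp; move: e.
  pose P e := meets_vars a b e /\ meets_vars c d e.
  apply: (ideal_gen_msupp (P := P) _ _ If) => [e e' [] e1 e2|].
    by split; exact: meets_varsD.
  move=> _ [g [h [gI hI ->]]] _ /msuppM_le/allpairsP[[x y] /= [xg yh ->]].
  split; last exact/meets_varsD/(vars_ideal_msupp hI).
  by rewrite addmC; exact/meets_varsD/(vars_ideal_msupp gI).
have X_vars x y (j : 'I_n.+1) : (x <= j <= y)%N -> vars_ideal x y ('X_j : S).
  move=> jxy; exists 1%N, (fun=> 'X_j), (fun=> 1); split; last first.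
    by rewrite big_ord1 mul1r.
  by move=> _; exists j.
have /fin_all_exists[g gP] : forall i : 'I_(size (msupp f)), exists g : S * S,
    [/\ (exists g1 g2,
          [/\ vars_ideal a b g1, vars_ideal c d g2 & g.1 = g1 * g2])
     & (f : S)@_(tnth (in_tuple (msupp f)) i) *:
          'X_[tnth (in_tuple (msupp f)) i] = g.2 * g.1].
  move=> i; set e := tnth _ i.
  have [[j jab ej] [j' jcd ej']] : meets_vars a b e /\ meets_vars c d e.
    by apply: fP; rewrite -mcoeff_msupp; exact: mem_tnth.
  have jj' : j != j'.
    apply: contraTneq jab => ->; rewrite negb_and -!ltnNge.
    by move/andP: jcd => [cj _]; rewrite (leq_trans bc cj) orbT.
  have le_e : (U_(j) + U_(j') <= e)%MM.
    apply/mnm_lepP => t; rewrite mnmDE !mnm1E.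
    have [<-|jt] := eqVneq j t; first by rewrite eq_sym (negPf jj') addn0 lt0n.
    by have [<-|] := eqVneq j' t; rewrite ?lt0n.
  exists ('X_j * 'X_j', f@_e *: 'X_[e - (U_(j) + U_(j'))]); split=> /=.
    by exists 'X_j, 'X_j'; split=> //; exact: X_vars.
  by rewrite -scalerAl -!mpolyXD submK.
exists (size (msupp f)), (fun i => (g i).1), (fun i => (g i).2); split.
  by move=> i; have [] := gP i.
rewrite [LHS]mpolyE big_tnth; apply: eq_bigr => i _.
by have [_] := gP i.
Qed.

End MonomialIdeals.

(** * Forms vanishing at a coordinate point *)

Section CoordinatePoint.
Variables (k : fieldType) (n m : nat).
Local Notation S := {mpoly k[n.+1]}.
Local Notation W := (dhomog n.+1 k m).
Local Notation M := 'X_{1..n.+1 < m.+1}.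

Lemma vanishing_ideal_dhomog (X : set 'rV[k]_n.+1) (f : W) :
  vanishing_ideal X (f : S) <->
  (forall v, X v -> (f : S).@[fun j => v 0 j] = 0).
Proof.
have fh : (f : S) \is m.-homog by exact: dhomog_is_dhomog.
split=> [fX v Xv|fX d v Xv].
  by rewrite -(fX m v Xv) pihomog_dE.
have [<-|dm] := eqVneq m d; first by rewrite pihomog_dE ?fX.
by rewrite (pihomog_ne0 dm) // meval0.
Qed.

(** At a point with c as its only nonzero coordinate, all the monomials of
    degree m vanish except the power of x_c, so f takes there the value
    f@_b * v c ^+ m. *)
Lemma mcoeff_coordinate_point (v : 'I_n.+1 -> k) (c : 'I_n.+1) (f : W) (b : M) :
  v c != 0 -> (forall j, j != c -> v j = 0) ->
  mdeg b = m -> (forall j, b j != 0%N -> j = c) ->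
  (f : S).@[v] = 0 -> (f : S)@_b = 0.
Proof.
move=> vc v0 bm bc fv.
have only_b (a : M) : ('X_[a] : S).@[v] != 0 -> (f : S)@_a != 0 -> a = b.
  move=> av /mcoeff_dhomog_neq0 am; apply/val_inj/mnmP => j /=.
  have ac t : t != c -> a t = 0%N.
    move=> tc; apply/eqP; apply: contraNT av => at0.
    by apply/eqP/(mevalX_eq0 at0)/v0.
  have bc0 t : t != c -> b t = 0%N.
    by move=> tc; apply/eqP; apply: contraNT tc => /bc/eqP.
  have [->|jc] := eqVneq j c; last by rewrite ac ?bc0.
  have degc (d : 'X_{1..n.+1}) :
      (forall t, t != c -> d t = 0%N) -> mdeg d = d c.
    by move=> d0; rewrite mdegE (bigD1 c) //= big1 ?addn0.
  by rewrite -(degc _ ac) -(degc _ bc0) am bm.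
have fb : (f : S).@[v] = (coef_proj [set b] f : S).@[v].
  apply: meval_dhomog_eq => a; rewrite mcoeff_proj finset.in_set1.
  case: (a =P b) => [_|ab]; first by rewrite eqxx.
  move=> fa; apply/eqP/negPn/negP => av; exact/ab/only_b.
have projb : (coef_proj [set b] f : S) = (f : S)@_b *: 'X_[b].
  apply/mpolyP => a; rewrite mcoeffZ mcoeffX.
  have [am|am] := eqVneq (mdeg a) m.
    have [a' ->] := bmultinom_exists am.
    rewrite mcoeff_proj finset.in_set1 (inj_eq val_inj) eq_sym.
    by case: (b =P a') => [->|]; rewrite ?mulr1 ?mulr0.
  rewrite (@dhomog_nemf_coeff _ _ mdeg m) //; last exact: dhomog_is_dhomog.
  by case: ((b : 'X_{1..n.+1}) =P a) am => [<-|]; rewrite ?bm ?eqxx ?mulr0.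
move: fv; rewrite fb projb mevalZ => /eqP; rewrite mulf_eq0 => /orP[/eqP//|].
rewrite mevalX (bigD1 c) //= big1 ?mulr1 => [|j jc].
  by rewrite expf_eq0 (negPf vc) andbF.
by have [->|/bc/eqP] := eqVneq (b j) 0%N; rewrite ?expr0 // (negPf jc).
Qed.

End CoordinatePoint.

(** * Vectors supported in consecutive blocks of coordinates *)

Section BlockSum.
Variables (V : zmodType) (n l : nat) (N : nat -> nat).
Hypothesis N_le : forall i j, (i <= j)%N -> (j <= l)%N -> (N i <= N j)%N.
Hypothesis N_n : N l = n.

(** Induction on i: once the vectors of smaller index are known to be 0, the
    coordinates of d i below N i.+1 are met by no other nonzero vector of the
    family, so they are 0, and then the last coordinate is the coordinate sum
    of d i. *)
Lemma block_sum_eq0 (d : 'I_l -> 'I_n.+1 -> V) :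
  (forall (i : 'I_l) (t : 'I_n.+1), ~~ (N i <= t <= N i.+1)%N -> d i t = 0) ->
  (forall i, \sum_t d i t = 0) ->
  (forall t, \sum_i d i t = 0) ->
  forall i t, d i t = 0.
Proof.
move=> dout drow dcol.
suff dp p : forall i : 'I_l, i = p :> nat -> forall t, d i t = 0.
  by move=> i; exact: dp erefl.
elim/ltn_ind: p => p IH i ip.
have d_lt (t : 'I_n.+1) : (t < N i.+1)%N -> d i t = 0.
  move=> ti; have := dcol t; rewrite (bigD1 i) //= big1 ?addr0 // => j ji.
  have [ji'|ij|/val_inj ji'] := ltngtP j i; last by rewrite ji' eqxx in ji.
    by rewrite (IH j) // -ip.
  apply: dout; rewrite negb_and -ltnNge (leq_trans ti) //.
  by rewrite N_le // ltnW.
have ci : (N i.+1 < n.+1)%N by rewrite ltnS -N_n N_le.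
move=> t; have [ti|it|ti] := ltngtP t (N i.+1); first exact: d_lt.
  by apply: dout; rewrite negb_and -!ltnNge it orbT.
have := drow i; rewrite (bigD1 t) //= big1 ?addr0 // => s st.
have [|lt_is|si] := ltngtP s (N i.+1); first exact: d_lt.
  by apply: dout; rewrite negb_and -!ltnNge lt_is orbT.
by move: st; rewrite -(inj_eq val_inj) /= si ti eqxx.
Qed.

End BlockSum.

(** * Monomials and forms on a chain of varieties *)

Section Chain.
Variables (k : fieldType) (n l m : nat) (N : nat -> nat).
Variable X : 'I_l -> set 'rV[k]_n.+1.
Local Notation S := {mpoly k[n.+1]}.
Local Notation W := (dhomog n.+1 k m).
Local Notation M := 'X_{1..n.+1 < m.+1}.
Local Notation in_block i b := (in_vars (N i) (N i.+1) b).

Hypothesis l_gt0 : (0 < l)%N.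
Hypothesis N0 : N 0%N = 0%N.
Hypothesis Nl : N l = n.
Hypothesis N_lt : forall i, (i < l)%N -> (N i < N i.+1)%N.
Hypothesis X_variety : forall i, projective_variety (X i).
Hypothesis X_chain : forall i j : 'I_l, j = i.+1 :> nat ->
  (X i `&` X j !=set0)%classic.
Hypothesis X_block : forall (i : 'I_l) v, X i v ->
  forall j : 'I_n.+1, (j < N i)%N || (N i.+1 < j)%N -> v 0 j = 0.

Lemma N_le i j : (i <= j)%N -> (j <= l)%N -> (N i <= N j)%N.
Proof.
elim: j => [|j IH]; first by rewrite leqn0 => /eqP->.
rewrite leq_eqVlt => /orP[/eqP->//|ij] jl.
by apply: leq_trans (IH ij (ltnW jl)) (ltnW (N_lt jl)).
Qed.

(** The monomials of degree m of T i in the variables of index at least N i.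
    Here i is the block of the least variable, which makes these sets
    disjoint. *)
Definition crossing_monomials (i : 'I_l.-1) : {set M} :=
  [set b : M | [&& mdeg b == m, in_vars (N i) n b,
    [exists j : 'I_n.+1, (j < N i.+1)%N && (b j != 0%N)] &
    [exists j : 'I_n.+1, (N i.+1 < j)%N && (b j != 0%N)]]].

(** The powers of x_(N i) and x_(N i.+1) shared with the neighbouring blocks are
    left out. *)
Definition own_monomials (i : 'I_l) : {set M} :=
  [set b : M | [&& mdeg b == m, in_block i b &
    [forall j : 'I_l, (j != i) ==> ~~ in_block j b]]].

Definition piece_monomials (p : 'I_l.-1 + 'I_l) : {set M} :=
  match p with inl i => crossing_monomials i | inr i => own_monomials i end.

Lemma crossing_not_block i (j : 'I_l) b :
  b \in crossing_monomials i -> ~~ in_block j b.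
Proof.
rewrite inE => /and4P[_ _ /existsP[s /andP[si bs]] /existsP[t /andP[it bt]]].
apply/negP => /in_varsP jb.
have /andP[js _] := jb _ bs; have /andP[_ tj] := jb _ bt.
have il : (i.+1 <= l)%N by have := ltn_ord i; rewrite ltn_predRL => /ltnW.
have [ji|ij] := leqP j i.
  have := leq_trans (leq_trans it tj) (N_le (ji : (j.+1 <= i.+1)%N) il).
  by rewrite ltnn.
have := leq_trans (leq_trans si (N_le ij (ltnW (ltn_ord j)))) js.
by rewrite ltnn.
Qed.

Lemma piece_monomials_disjoint p q :
  p != q -> [disjoint piece_monomials p & piece_monomials q].
Proof.
have crossing_lt (i j : 'I_l.-1) b : (i < j)%N ->
    b \in crossing_monomials i -> b \in crossing_monomials j -> False.
  rewrite !inE => ij /and4P[_ _ /existsP[s /andP[si bs]] _].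
  move=> /and4P[_ /in_varsP jb _ _].
  have /andP[js _] := jb _ bs.
  have jl : (j <= l)%N by apply: ltnW (leq_trans (ltn_ord j) (leq_pred l)).
  by have := leq_trans (leq_trans si (N_le ij jl)) js; rewrite ltnn.
apply: contraNT => /pred0Pn[b /andP[/= bp bq]]; apply/eqP.
case: p q bp bq => [i|i] [j|j] /= bi bj.
- have [ij|ji|/val_inj->//] := ltngtP i j.
    by have := crossing_lt _ _ _ ij bi bj.
  by have := crossing_lt _ _ _ ji bj bi.
- have := crossing_not_block j bi; move: bj; rewrite inE.
  by case/and3P => _ ->.
- have := crossing_not_block i bj; move: bi; rewrite inE.
  by case/and3P => _ ->.
move: bi bj; rewrite !inE => /and3P[_ _ /forallP/(_ j)].
have [->//|/= _ jb] := eqVneq j i.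
by rewrite (negPf jb) andbF.
Qed.

(** A monomial lying in no block crosses the end of the block which contains
    its least variable; that block is not the last one. *)
Lemma piece_monomials_cover (b : M) : mdeg b = m ->
  (exists p, b \in piece_monomials p) \/
  (exists i j : 'I_l, [/\ i != j, in_block i b & in_block j b]).
Proof.
move=> bm; have [/existsP[i bi]|/existsPn nb] :=
    boolP [exists i : 'I_l, in_block i b].
  have [/existsP[j /andP[ji bj]]|/existsPn nj] :=
      boolP [exists j : 'I_l, (j != i) && in_block j b].
    by right; exists j, i.
  left; exists (inr i); rewrite inE bm eqxx bi /=.
  by apply/forallP => j; have := nj j; rewrite negb_and implybE.
left; pose P c := [exists j : 'I_n.+1, (j == c :> nat) && (b j != 0%N)].
have [c0 Pc0] : exists c, P c.
  apply: contrapT => nP; have /negP := nb (Ordinal l_gt0); apply.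
  apply/in_varsP => j bj; case: nP; exists j; apply/existsP.
  by exists j; rewrite eqxx.
(* c is the index of the least variable of b, and i the block of c. *)
case: (ex_minnP (ex_intro P _ Pc0)) => c /existsP[s /andP[/eqP sc bs]] cmin.
have cle t : b t != 0%N -> (c <= t)%N.
  by move=> bt; apply: cmin; apply/existsP; exists t; rewrite eqxx.
pose Q i := (i < l)%N && (N i <= c)%N.
have Q0 : Q 0%N by rewrite /Q l_gt0 N0.
have Ql i : Q i -> (i <= l)%N by move=> /andP[/ltnW].
case: (ex_maxnP (ex_intro Q _ Q0) Ql) => i /andP[il ic] imax.
have tn (t : 'I_n.+1) : (t <= n)%N by rewrite -ltnS.
have il1 : (i.+1 < l)%N.
  rewrite ltn_neqAle il andbT; apply/negP => /eqP iE.
  have /negP := nb (Ordinal il); apply; apply/in_varsP => t bt /=.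
  by rewrite (leq_trans ic (cle _ bt)) iE Nl tn.
have il' : (i < l.-1)%N by rewrite ltn_predRL.
have ci : (c < N i.+1)%N.
  rewrite ltnNge; apply/negP => ic'; have := imax i.+1.
  by rewrite /Q il1 ic' ltnn => /(_ isT).
exists (inl (Ordinal il')); rewrite inE bm eqxx /=; apply/and3P; split.
- by apply/in_varsP => t bt; rewrite (leq_trans ic (cle _ bt)) tn.
- by apply/existsP; exists s; rewrite sc ci.
apply: contraT => /existsPn nt; have /negP := nb (Ordinal il); case.
apply/in_varsP => t bt /=; rewrite (leq_trans ic (cle _ bt)) /=.
by have := nt t; rewrite bt andbT -leqNgt.
Qed.

Lemma meval_out_block (i : 'I_l) v (b : 'X_{1..n.+1}) : X i v ->
  ~~ in_block i b -> ('X_[b] : S).@[fun j => v 0 j] = 0.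
Proof.
move=> Xv /forallPn[j]; rewrite negb_imply => /andP[bj ij].
apply: (mevalX_eq0 bj); apply: (X_block Xv).
by move: ij; rewrite negb_and -!ltnNge.
Qed.

(** The blocks of X i and X i.+1 share only the coordinate N i.+1, which is
    therefore the only nonzero one of a point of their intersection. *)
Lemma chain_coordinate_point (i j : 'I_l) : j = i.+1 :> nat ->
  exists (v : 'rV[k]_n.+1) (c : 'I_n.+1),
    [/\ X i v, X j v, c = N j :> nat, v 0 c != 0 &
        forall t, t != c -> v 0 t = 0].
Proof.
move=> ji; have [v [Xi Xj]] := X_chain ji.
have cn : (N j < n.+1)%N by rewrite ltnS -Nl N_le // ltnW.
have v0 t : t != Ordinal cn -> v 0 t = 0.
  rewrite -(inj_eq val_inj) /= neq_ltn => /orP[tj|jt].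
    by apply: (X_block Xj); rewrite tj.
  by apply: (X_block Xi); rewrite -ji jt orbT.
exists v, (Ordinal cn); split=> //.
have [_ [F [_ XF]]] := X_variety i.
have [vn0 _] : vanishing_locus F v by rewrite -XF.
have /rV0Pn[t vt] := vn0.
by have [<-//|/v0 vt0] := eqVneq t (Ordinal cn); rewrite vt0 eqxx in vt.
Qed.

(** A monomial in block i and in another block is a power of the variable which
    block i shares with its neighbour on the side of that block. *)
Lemma mcoeff_shared (i j : 'I_l) (b : M) (f : W) :
  i != j -> mdeg b = m -> in_block i b -> in_block j b ->
  (forall v, X i v -> (f : S).@[fun t => v 0 t] = 0) -> (f : S)@_b = 0.
Proof.
move=> ij bm /in_varsP bi /in_varsP bj fX.
have [lt_ij|lt_ji|/val_inj eq_ij] := ltngtP i j; last 1 first.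
- by rewrite eq_ij eqxx in ij.
  have il : (i.+1 < l)%N by apply: leq_ltn_trans lt_ij (ltn_ord j).
  have [v [c [Xv _ cE vc v0]]] := @chain_coordinate_point i (Ordinal il) erefl.
  apply: (mcoeff_coordinate_point vc v0 bm _ (fX v Xv)) => t bt.
  apply/val_inj/eqP; rewrite /= cE eqn_leq.
  have /andP[_ ->] := bi t bt; have /andP[jt _] := bj t bt.
  by rewrite (leq_trans _ jt) // N_le // ltnW.
have il : (i.-1 < l)%N by apply: leq_ltn_trans (leq_pred i) (ltn_ord i).
have iE : i = (Ordinal il).+1 :> nat by rewrite /= (ltn_predK lt_ji).
have [v [c [_ Xv cE vc v0]]] := chain_coordinate_point iE.
apply: (mcoeff_coordinate_point vc v0 bm _ (fX v Xv)) => t bt.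
apply/val_inj/eqP; rewrite /= cE eqn_leq.
have /andP[-> _] := bi t bt; have /andP[_ tj] := bj t bt.
by rewrite (leq_trans tj) // N_le // ltnW.
Qed.

Lemma crossing_piece_exists (i : 'I_l.-1) : exists V : {vspace W},
  [/\ graded_piece (ideal_mul (vars_ideal (N i) (N i.+1).-1)
                              (vars_ideal (N i.+1).+1 n)
                    `&` subring_vars (N i) n)%classic V,
      supported (crossing_monomials i) V,
      (forall f : W,
        (forall b : M, b \notin crossing_monomials i -> (f : S)@_b = 0) ->
        f \in V) &
      forall B, coef_basis V B <-> B = crossing_monomials i].
Proof.
pose P (f : W) := forall b : M, b \notin crossing_monomials i -> (f : S)@_b = 0.
have [V VP] : exists V : {vspace W}, forall f, f \in V <-> P f.
  apply: subspace_exists => [b _|a f g f0 g0 b bE]; first exact: mcoeff0.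
  by rewrite mcoeffD mcoeffZ f0 ?g0 // mulr0 addr0.
have VE : supported (crossing_monomials i) V by move=> f /VP.
have EV (f : W) : P f -> f \in V by move/VP.
exists V; split=> //; last first.
  by apply: coef_basis_monomial => // b; rewrite inE => /and4P[/eqP].
have Nn : (N i.+1 <= n)%N.
  by rewrite -Nl N_le //; have := ltn_ord i; rewrite ltn_predRL => /ltnW.
have N_gt0 : (0 < N i.+1)%N.
  apply: leq_ltn_trans (N_lt _) => //.
  exact: leq_trans (ltn_ord i) (leq_pred l).
move=> f; rewrite VP; split=> [f0|[]].
  have inE_ e : (f : S)@_e != 0 -> [/\ in_vars (N i) n e,
      meets_vars (N i) (N i.+1).-1 e & meets_vars (N i.+1).+1 n e].
    move=> fe; have [b eb] := bmultinom_exists (mcoeff_dhomog_neq0 fe).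
    have : b \in crossing_monomials i.
      by apply: contraNT fe => /f0; rewrite eb => ->.
    rewrite inE eb => /and4P[_ ib /existsP[s /andP[si bs]]].
    move=> /existsP[t /andP[it bt]].
    split=> //.
      exists s => //; have /andP[-> _] := in_varsP _ _ _ ib _ bs.
      by rewrite -ltnS prednK.
    by exists t => //; rewrite it -ltnS ltn_ord.
  split; last by apply/subring_varsP => e /inE_[].
  apply/mul_vars_idealP => [|e /inE_[_ e1 e2]] //.
  by rewrite prednK // leqW.
move=> /mul_vars_idealP fT /subring_varsP fv b; apply: contraNeq => fb.
have [|[s /andP[_ si] bs] [t /andP[it _] bt]] := fT _ _ fb.
  by rewrite prednK // leqW.
rewrite inE (mcoeff_dhomog_neq0 fb) eqxx fv //=; apply/andP; split.
  by apply/existsP; exists s; rewrite bs andbT -[N i.+1]prednK.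
by apply/existsP; exists t; rewrite it bt.
Qed.

Lemma own_piece_exists (i : 'I_l) : exists V : {vspace W},
  graded_piece (vanishing_ideal (X i) `&` subring_vars (N i) (N i.+1))%classic V
  /\ supported (own_monomials i) V.
Proof.
pose P (f : W) := (forall v, X i v -> (f : S).@[fun t => v 0 t] = 0) /\
  (forall c, (f : S)@_c != 0 -> in_block i c).
have [V VP] : exists V : {vspace W}, forall f, f \in V <-> P f.
  apply: subspace_exists => [|a f g [f1 f2] [g1 g2]].
    by split=> [v _|c]; rewrite ?meval0 // mcoeff0 eqxx.
  split=> [v Xv|c]; first by rewrite mevalD mevalZ f1 // g1 // mulr0 addr0.
  rewrite mcoeffD mcoeffZ; have [->|/f2//] := eqVneq (f : S)@_c 0.
  by rewrite mulr0 add0r => /g2.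
exists V; split=> f.
  rewrite VP; split=> [[f1 f2]|]; last first.
    by move=> [/vanishing_ideal_dhomog f1 /subring_varsP f2].
  by split; [apply/vanishing_ideal_dhomog|apply/subring_varsP].
move=> /VP[f1 f2] b; apply: contraNeq => fb; rewrite inE.
rewrite (mcoeff_dhomog_neq0 fb) eqxx f2 //=.
apply/forallP => j; apply/implyP => ji.
apply/negP => bj; move/eqP: (fb); apply.
have ij : i != j by rewrite eq_sym.
exact: mcoeff_shared ij (mcoeff_dhomog_neq0 fb) (f2 _ fb) bj f1.
Qed.

(** The degree m piece of I_X is the sum of the pieces.  A form of the piece of
    X i vanishes on the other components because its monomials lie in no other
    block.  Conversely, on X i a form of I_X takes the same values as its part
    supported on the monomials of block i alone, since the shared ones have
    coefficient 0 and all the others vanish on X i. *)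
Lemma graded_piece_chain (U : 'I_l.-1 + 'I_l -> {vspace W}) :
  (forall p, supported (piece_monomials p) (U p)) ->
  (forall i (f : W),
     (forall b : M, b \notin crossing_monomials i -> (f : S)@_b = 0) ->
     f \in U (inl i)) ->
  (forall i, graded_piece (vanishing_ideal (X i) `&`
     subring_vars (N i) (N i.+1))%classic (U (inr i))) ->
  graded_piece (\bigcap_i vanishing_ideal (X i))%classic (\sum_p U p)%VS.
Proof.
move=> Usupp Ucross Uown f; split=> [/memv_sumP[g gU ->] i _|fX].
  apply/vanishing_ideal_dhomog => v Xv.
  rewrite (raddf_sum (@mpoly_of_dhomog n.+1 k m)) raddf_sum /=.
  apply: big1 => p _; have gp := gU p isT.
  have [->|pi] := eqVneq p (inr i).
    have /Uown[/vanishing_ideal_dhomog gX _] := gU (inr i) isT.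
    exact: gX.
  rewrite (@meval_dhomog_eq _ _ _ _ _ 0) ?meval0 // => b; rewrite mcoeff0.
  move=> gb; have : b \in piece_monomials p.
    by apply: contraNT gb => /(Usupp _ _ gp)/eqP.
  case: p pi {gp gb} => [j _|j ji] /= bj.
    exact: meval_out_block Xv (crossing_not_block i bj).
  apply: (meval_out_block Xv); move: bj.
  rewrite inE => /and3P[_ _ /forallP/(_ i)].
  by move/implyP; apply; apply: contraNneq ji => ->.
have fv i v : X i v -> (f : S).@[fun t => v 0 t] = 0.
  by have /vanishing_ideal_dhomog := fX i I; apply.
have shared0 (i j : 'I_l) (b : M) :
    i != j -> in_block i b -> in_block j b -> (f : S)@_b = 0.
  move=> ij bi bj; apply/eqP/negPn/negP => fb; move/eqP: (fb); apply.
  exact: mcoeff_shared ij (mcoeff_dhomog_neq0 fb) bi bj (fv i).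
apply/memv_sumP.
exists (fun p => coef_proj (piece_monomials p) f) => [[i|i] _|].
- by apply: Ucross => b /negPf bi; rewrite mcoeff_proj /= bi.
- apply/Uown; split.
    apply/vanishing_ideal_dhomog => v Xv; rewrite -(fv i v Xv).
    apply: meval_dhomog_eq => b; rewrite mcoeff_proj /=.
    case: ifP => [_|bi fb]; first by rewrite eqxx.
    apply: (meval_out_block Xv); apply/negP => ib.
    move: fb; rewrite eq_sym => fb; move: bi.
    rewrite inE (mcoeff_dhomog_neq0 fb) eqxx ib /= => /negP; apply.
    apply/forallP => j; apply/implyP; rewrite eq_sym => ij; apply/negP => bj.
    by move/eqP: fb; apply; exact: shared0 ij ib bj.
  apply/subring_varsP => c fc.
  have [b cb] := bmultinom_exists (mcoeff_dhomog_neq0 fc).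
  move: fc; rewrite cb mcoeff_proj; case: ifP => [|_]; last by rewrite eqxx.
  by rewrite inE => /and3P[].
apply: dhomog_eqP => b.
rewrite (raddf_sum (@mpoly_of_dhomog n.+1 k m)) raddf_sum /=.
under eq_bigr do rewrite mcoeff_proj.
have [fb0|fb] := eqVneq (f : S)@_b 0.
  by rewrite fb0 big1 // => p _; case: ifP.
have [[p bp]|[i [j [ij bi bj]]]] :=
    piece_monomials_cover (mcoeff_dhomog_neq0 fb).
  rewrite (bigD1 p) //= bp big1 ?addr0 // => q qp.
  by rewrite (disjointFl (piece_monomials_disjoint qp) bp).
by rewrite (shared0 i j) // eqxx in fb.
Qed.

(** * State polytopes of a chain of varieties *)

Definition crossing_weight (R : realType) (i : 'I_l.-1) : 'rV[R]_n.+1 :=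
  \sum_(b in crossing_monomials i) exponent_vector R b.

Lemma state_polytope_crossing (R : realType) (i : 'I_l.-1) :
  state_polytope (N i) n
    (ideal_mul (vars_ideal (N i) (N i.+1).-1) (vars_ideal (N i.+1).+1 n)
       `&` subring_vars (k := k) (N i) n)%classic m
  = [set crossing_weight R i]%classic.
Proof.
have [V [JV VE _ VB]] := crossing_piece_exists i.
apply: convex_hull1 => x.
have Ein (c : M) :
    c \in crossing_monomials i -> mdeg c = m /\ in_vars (N i) n c.
  by rewrite inE => /and4P[/eqP].
split=> [/(statesP _ JV VE Ein)[B /VB-> //]|->].
by apply/(statesP _ JV VE Ein); exists (crossing_monomials i) => //; exact/VB.
Qed.

(** The bases for I_X are the unions of bases for the pieces.  A crossing piece
    has a single basis, all of its monomials, whence the constant summand. *)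
Lemma states_chain (R : realType) (x : 'rV[R]_n.+1) :
  states 0 n (\bigcap_i vanishing_ideal (X i))%classic m x <->
  exists2 b : 'I_l -> 'rV[R]_n.+1,
    forall i : 'I_l, states (N i) (N i.+1)
      (vanishing_ideal (X i) `&` subring_vars (N i) (N i.+1))%classic m (b i) &
    x = \sum_i crossing_weight R i + \sum_i b i.
Proof.
have /fin_all_exists[UT UTP] := crossing_piece_exists.
have /fin_all_exists[UO UOP] := own_piece_exists.
pose U p := match p with inl i => UT i | inr i => UO i end.
have Usupp p : supported (piece_monomials p) (U p).
  by case: p => i; [have [] := UTP i|have [] := UOP i].
have JV :
    graded_piece (\bigcap_i vanishing_ideal (X i))%classic (\sum_p U p)%VS.
  by apply: graded_piece_chain => // i; [have [] := UTP i|have [] := UOP i].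
have allsupp : supported [set b : M | mdeg b == m] (\sum_p U p)%VS.
  move=> g _ b; rewrite inE => bm.
  by apply: (@dhomog_nemf_coeff _ _ mdeg m) => //; exact: dhomog_is_dhomog.
have allP (c : M) :
    c \in [set b : M | mdeg b == m] -> mdeg c = m /\ in_vars 0 n c.
  rewrite inE => /eqP->; split=> //; apply/in_varsP => j _.
  by rewrite /= -ltnS ltn_ord.
have ownP (i : 'I_l) (c : M) :
    c \in own_monomials i -> mdeg c = m /\ in_block i c.
  by rewrite inE => /and3P[/eqP].
have weight_sum (C : 'I_l.-1 + 'I_l -> {set M}) :
    (forall p, coef_basis (U p) (C p)) ->
    \sum_(c in \bigcup_p C p) exponent_vector R c =
    \sum_i crossing_weight R i +
      \sum_i \sum_(c in C (inr i)) exponent_vector R c.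
  move=> CU; rewrite partition_disjoint_bigcup => [|p q pq]; last first.
    have CE r := coef_basis_sub (Usupp r) (CU r).
    exact: (disjointW (CE p) (CE q) (piece_monomials_disjoint pq)).
  rewrite big_sumType /=; congr (_ + _); apply: eq_bigr => i _.
  have [_ _ _ UTB] := UTP i.
  by have /UTB-> := CU (inl i).
split.
  move=> /(statesP _ JV allsupp allP)[B].
  move=> /(coef_basis_sum piece_monomials_disjoint Usupp)[C CU ->] ->.
  exists (fun i => \sum_(c in C (inr i)) exponent_vector R c); last first.
    exact: weight_sum.
  move=> i; apply/(statesP _ (UOP i).1 (UOP i).2 (ownP i)).
  by exists (C (inr i)) => //; exact: (CU (inr i)).
move=> [b bP ->].
have /fin_all_exists2[C CU bE] : forall i, exists2 B, coef_basis (UO i) B &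
    b i = \sum_(c in B) exponent_vector R c.
  by move=> i; apply/(statesP _ (UOP i).1 (UOP i).2 (ownP i)).
pose D p := match p with inl i => crossing_monomials i | inr i => C i end.
have DU p : coef_basis (U p) (D p).
  by case: p => i //=; have [_ _ _ UTB] := UTP i; apply/UTB.
apply/(statesP _ JV allsupp allP); exists (\bigcup_p D p).
  by apply/(coef_basis_sum piece_monomials_disjoint Usupp); exists D.
by rewrite weight_sum //=; congr (_ + _); apply: eq_bigr.
Qed.

(** The differences x i - y i satisfy the hypotheses of [block_sum_eq0], by the
    two facts of [weight_block]. *)
Lemma block_sum_inj (R : realType) (x y : 'I_l -> 'rV[R]_n.+1) :
  let P (i : 'I_l) := convex_hull (states (N i) (N i.+1)
      (vanishing_ideal (X i) `&` subring_vars (N i) (N i.+1))%classic m) in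
  (forall i, P i (x i)) -> (forall i, P i (y i)) ->
  \sum_i x i = \sum_i y i -> forall i, x i = y i.
Proof.
move=> P xP yP xy i; apply/rowP => t; apply/eqP; rewrite -subr_eq0; apply/eqP.
have coordE j z (s : 'I_n.+1) : P j z -> ~~ (N j <= s <= N j.+1)%N -> z 0 s = 0.
  move=> Pz js; have : z *m delta_mx s (0 : 'I_1) = 0.
    apply: convex_hull_mulmx Pz => w /weight_block[w0 _].
    by rewrite -colE; apply/colP => u; rewrite !mxE ord1 w0.
  by rewrite -colE => /colP/(_ 0); rewrite !mxE.
have degE j : exists c, forall z, P j z -> \sum_s z 0 s = c.
  have [V [JV _]] := own_piece_exists j; exists (m * \dim V)%:R => z Pz.
  have : z *m (const_mx 1 : 'cV_n.+1) = const_mx (m * \dim V)%:R.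
    apply: convex_hull_mulmx Pz => w /weight_block[_ /(_ V JV) wE].
    apply/matrixP => u u'; rewrite !mxE ord1 -wE.
    by apply: eq_bigr => s _; rewrite mxE mulr1.
  move=> /matrixP/(_ 0 0); rewrite !mxE => <-.
  by apply: eq_bigr => s _; rewrite mxE mulr1.
apply: (@block_sum_eq0 _ n l N N_le Nl (fun i t => x i 0 t - y i 0 t)).
- by move=> j s js; rewrite (coordE j (x j)) // (coordE j (y j)) // subrr.
- by move=> j; have [c cE] := degE j; rewrite sumrB !cE // subrr.
move=> s; rewrite sumrB -!summxE; apply/eqP; rewrite subr_eq0; apply/eqP.
by rewrite xy.
Qed.

End Chain.

Local Open Scope classical_set_scope.

(* X i, for i = 0, ..., l - 1, is the component X_(i+1) of the chain; it spans
   the coordinates N i, ..., N (i + 1).  Likewise tau i is the summand of tau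
   coming from T_(i+1). *)
Theorem corollary2p4 (R : realType) (k : closedFieldType)
  (hchar : [pchar k] =i pred0) (n l : nat) (hl : (0 < l)%N)
  (X : 'I_l -> set 'rV[k]_n.+1)
  (hX : forall i, projective_variety (X i))
  (hchain : forall i j : 'I_l, i != j ->
     (X i `&` X j !=set0 <-> (j = i.+1 :> nat \/ i = j.+1 :> nat)))
  (N : nat -> nat) (hN0 : N 0%N = 0%N) (hNl : N l = n)
  (hN : forall i, (i < l)%N -> (N i < N i.+1)%N)
  (hsupp : forall (i : 'I_l) (v : 'rV[k]_n.+1), X i v ->
     forall j : 'I_n.+1, (j < N i)%N || (N i.+1 < j)%N -> v 0 j = 0)
  (m g : nat) (gi : 'I_l -> nat)
  (hg : gotzmann_number (\bigcap_i vanishing_ideal (X i)) g)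
  (hgi : forall i, gotzmann_number (vanishing_ideal (X i)) (gi i))
  (hm : (g <= m)%N) (hmi : forall i, (gi i <= m)%N) :
  let IX : set {mpoly k[n.+1]} := \bigcap_i vanishing_ideal (X i) in
  let T (i : 'I_l.-1) : set {mpoly k[n.+1]} :=
    ideal_mul (vars_ideal (N i) (N i.+1).-1) (vars_ideal (N i.+1).+1 n) in
  exists tau : 'I_l.-1 -> 'rV[R]_n.+1,
    (forall i : 'I_l.-1,
       state_polytope (N i) n (T i `&` subring_vars (N i) n) m = [set tau i])
    /\
    vertices (state_polytope 0 n IX m) =
      [set \sum_(i < l.-1) tau i + \sum_(i < l) v i |
         v in [set v : 'I_l -> 'rV[R]_n.+1 | forall i : 'I_l,
           vertices (state_polytope (N i) (N i.+1)
             (vanishing_ideal (X i) `&` subring_vars (N i) (N i.+1)) m)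
             (v i)]].
Proof.
move=> IX T.
have hadj (i j : 'I_l) : j = i.+1 :> nat -> X i `&` X j !=set0.
  move=> ji; apply/(hchain i j); last by left.
  by rewrite -(inj_eq val_inj) /= ji neq_ltn ltnSn.
exists (@crossing_weight n l m N R); split=> [i|].
  exact: state_polytope_crossing.
have VE := vertices_minkowski_sum 
  (fun x => states_chain m hl hN0 hNl hN hX hadj hsupp x)
  (fun x y => block_sum_inj (m := m) hNl hN hX hadj hsupp (x := x) (y := y)).
apply/seteqP; split=> v /=; first by move=> /VE[b bV ->]; exists b.
by move=> [b bV <-]; apply/VE; exists b.
Qed.
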